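(* Let $a<b$ be real and let $f\in C^1([a,b])$. Then $f''\in\mathcal{A}_c([a,b])$ (as the distributional derivative of $f'$), and $$\int_a^b f(x)\,dx=\frac{b-a}{2}\left[f(a)+f(b)\right]+E(f),\qquad |E(f)|\le\frac{\|f''\|(b-a)^2}{4}.$$ Moreover, for each integer $n\ge1$ and the uniform partition $x_i=a+(b-a)i/n$, $0\le i\le n$, $$\int_a^b f(x)\,dx=\frac{b-a}{2n}\left[f(a)+2\sum_{i=1}^{n-1}f(x_i)+f(b)\right]+E(f),\qquad |E(f)|\le\frac{\|f''\|(b-a)^2}{4n}.$$
   Context: $\mathcal{B}_c([a,b])=\{F\in C([a,b]) : F(a)=0\}$ with the uniform norm. $\mathcal{A}_c([a,b])$ is the set of distributions that are the distributional derivative $F'$ of some $F\in\mathcal{B}_c([a,b])$, where $\langle F',\psi\rangle=-\int_a^bF(x)\psi'(x)\,dx$ for test functions $\psi$; it is the completion of the space of Henstock–Kurzweil integrable functions on $[a,b]$ in the Alexiewicz norm. For $g\in\mathcal{A}_c([a,b])$ there is a unique primitive $F\in\mathcal{B}_c([a,b])$ with $F'=g$; the continuous primitive integral is $\int_a^x g=F(x)-F(a)$, and the Alexiewicz norm is $\|g\|=\sup_{x\in[a,b]}\left|\int_a^xg\right|=\|F\|_\infty$. For $f\in C^1([a,b])$, the primitive of $f''$ in $\mathcal{B}_c([a,b])$ is $f'-f'(a)$. *)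

(* Defs.v *)
From HB Require Import structures.
From mathcomp Require Import all_boot all_order all_algebra.
From mathcomp Require Import all_classical all_reals all_analysis.

Set Implicit Arguments.
Unset Strict Implicit.
Unset Printing Implicit Defensive.
Import Order.TTheory GRing.Theory Num.Theory.
Import numFieldNormedType.Exports.

Local Open Scope classical_set_scope.
Local Open Scope ring_scope.

(** Functions on [[a, b]] are represented by functions [R -> R] of which only
    the values on [[a, b]] matter. *)

Section on_segment.
Context {R : realType}.
Implicit Types (a b : R) (f F phi psi : R -> R) (T : (R -> R) -> R).

(** The difference quotient is taken within [[a, b]], so the derivative is
    one-sided at the endpoints. *)
Definition diffquo f (x y : R) : R := (f y - f x) / (y - x).

Definition derivable_seg a b f (x : R) : Prop :=
  cvg (diffquo f x @ within `[a, b] x^').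

Definition derive_seg a b f (x : R) : R :=
  lim (diffquo f x @ within `[a, b] x^').

Definition C1_seg a b : set (R -> R) :=
  [set f | (forall x, x \in `[a, b] -> derivable_seg a b f x) /\
           {within `[a, b], continuous (derive_seg a b f)}].

Definition tsupport psi : set R := closure [set x | psi x != 0].

Definition smooth psi : Prop := forall (n : nat) (x : R), derivable (psi^`(n))%classic x 1.

(** The supports lie in the open interval: only then does the derivative of a
    constant vanish, hence is the primitive of a distribution vanishing at [a]
    unique. *)
Definition test_function a b : set (R -> R) :=
  [set psi | smooth psi /\ compact (tsupport psi) /\
             tsupport psi `<=` `]a, b[ ].

(** Distributions are represented by functionals on [R -> R] of which only the
    values at test functions matter. *)
Definition distribution_eq a b T1 T2 : Prop :=
  forall psi, test_function a b psi -> T1 psi = T2 psi.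

(** Continuity for the usual inductive limit topology, in terms of the
    seminorms on test functions supported in a fixed compact set. *)
Definition distribution a b : set ((R -> R) -> R) :=
  [set T |
    (forall (c : R) phi psi, test_function a b phi -> test_function a b psi ->
       T (fun x => c * phi x + psi x) = c * T phi + T psi) /\
    (forall K : set R, compact K -> K `<=` `]a, b[ ->
       exists (C : R) (N : nat), forall psi, test_function a b psi ->
         tsupport psi `<=` K ->
         `|T psi| <= C * \sum_(k < N.+1) sup [set `|(psi^`(k))%classic x| | x in K])].

Definition distr_derive a b F : (R -> R) -> R :=
  fun psi => - \int[lebesgue_measure]_(x in `[a, b]) (F x * (psi^`())%classic x).

Definition B_c a b : set (R -> R) :=
  [set F | {within `[a, b], continuous F} /\ F a = 0].

Definition primitives a b T : set (R -> R) :=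
  [set F | B_c a b F /\ distribution_eq a b T (distr_derive a b F)].

Definition A_c a b : set ((R -> R) -> R) :=
  [set T | distribution a b T /\ exists F, primitives a b T F].

(** The primitive is unique as a function on [[a, b]]; any representative
    will do. *)
Definition primitive a b T : R -> R := xget (cst 0) (primitives a b T).

Definition cp_integral a b T (x : R) : R := primitive a b T x - primitive a b T a.

Definition alexiewicz_norm a b T : R :=
  sup [set `|cp_integral a b T x| | x in `[a, b]].

End on_segment.

(* Main.v *)
(* Writing g = f', the primitive of f'' vanishing at a is g - g(a): two
   continuous primitives of a distribution differ by a constant, as one sees by
   testing against the difference of two translates of a smooth step built from
   exp(-1/x). Hence |f' - f'(a)| <= ||f''|| on [a, b], so f lies within
   ||f''|| |x - c| of the affine function of slope f'(a) agreeing with f at c.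
   On a subinterval of length h, integrate this bound with c the left endpoint
   over the left half and with c the right endpoint over the right half: the
   terms in f'(a) cancel and the error is at most ||f''|| h^2 / 4. The slope
   f'(a) is the same on all subintervals, so the n errors add up to
   n ||f''|| ((b - a) / n)^2 / 4. *)
Require Import Defs.
From HB Require Import structures.
From mathcomp Require Import all_boot all_order all_algebra.
From mathcomp Require Import ring lra.
From mathcomp Require Import all_classical all_reals all_analysis.

Set Implicit Arguments.
Unset Strict Implicit.
Unset Printing Implicit Defensive.
Import Order.TTheory GRing.Theory Num.Theory.
Import numFieldNormedType.Exports.

Local Open Scope classical_set_scope.
Local Open Scope ring_scope.

(** * Smooth functions and the flat functions built from [exp(-1/x)] *)

Section smooth_functions.
Context {R : realType}.
Implicit Types (f g : R -> R) (x : R) (A : set (R -> R)).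

(** A coinduction principle: the derivative stays in [A], so induction on the order, peeling off the
    innermost derivative, reaches every iterate. It replaces closed formulas for higher
    derivatives. *)
Lemma smooth_coind A : (forall f, A f ->
    (forall x, derivable f x 1) /\ A (f^`())%classic) ->
  A `<=` smooth.
Proof.
move=> HA f Af n; elim: n f Af => [|n IHn] f Af x.
  by rewrite derive1n0; exact: (HA f Af).1.
by rewrite derive1Sn; apply: IHn; exact: (HA f Af).2.
Qed.

Lemma smooth_primitive f g : (forall x, is_derive x 1 f (g x)) -> smooth g ->
  smooth f.
Proof.
move=> fg sg [|n] x; first by rewrite derive1n0; have [] := fg x.
rewrite derive1Sn (_ : derive1 f = g); first exact: sg.
by apply/funext => y; rewrite derive1E; exact: derive_val.
Qed.

Lemma is_derive_shift f (c x df : R) : is_derive (x - c) 1 f df ->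
  is_derive x 1 (fun y => f (y - c)) df.
Proof.
move=> fx; rewrite -[df]mulr1.
apply: (@is_derive1_comp _ f (fun y => y - c)).
rewrite -[X in is_derive _ _ _ X]subr0; exact: is_deriveB.
Qed.

Lemma smooth_derive f : smooth f -> smooth (f^`())%classic.
Proof. by move=> sf n x; rewrite -derive1Sn; exact: sf. Qed.

Lemma smooth_shift_sub f (c d : R) : smooth f ->
  smooth (fun x => f (x - c) - f (x - d)).
Proof.
move=> sf.
(* The class of all such differences, with [c] and [d] fixed and [h] any smooth function, is closed
   under differentiation: [h] is simply replaced by its derivative. *)
apply: (@smooth_coind [set g | exists2 h, smooth h &
  g = fun x => h (x - c) - h (x - d)]); last by exists f.
move=> _ [h sh ->].
have dh x : is_derive x 1 (fun x => h (x - c) - h (x - d))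
    (h^`()%classic (x - c) - h^`()%classic (x - d)).
  have dh (y : R) : is_derive y 1 h (h^`()%classic y).
    by rewrite derive1E; apply/derivableP; exact: (sh 0%N).
  by apply: is_deriveB; apply: is_derive_shift.
split=> [x|]; first by have [] := dh x.
exists (h^`())%classic; first exact: smooth_derive.
by apply/funext => x; rewrite derive1E; exact: derive_val.
Qed.

(** The function [x^(-k) exp(-1/x)], extended by [0] to [x <= 0]. The powers [k] are carried along
    so that derivatives are linear combinations of members of the same family. *)
Definition flat_exp (k : nat) (x : R) : R :=
  if 0 < x then x^-1 ^+ k * expR (- x^-1) else 0.

Lemma flat_exp_ge0 k x : 0 <= flat_exp k x.
Proof.
rewrite /flat_exp; case: ifPn => // x0.
by rewrite mulr_ge0 ?expR_ge0// exprn_ge0// invr_ge0 ltW.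
Qed.

Lemma flat_exp_gt0 k x : 0 < x -> 0 < flat_exp k x.
Proof. by move=> x0; rewrite /flat_exp x0 mulr_gt0 ?expR_gt0// exprn_gt0// invr_gt0. Qed.

Lemma flat_exp_le0 k x : x <= 0 -> flat_exp k x = 0.
Proof. by rewrite /flat_exp leNgt => /negbTE ->. Qed.

(** With [y = 1/x], the exponential series gives [y^(k+1) / (k+1)! <= exp y]; dividing by [y exp y]
    yields the bound. It controls the difference quotient at [0]. *)
Lemma flat_exp_le k x : 0 <= x -> flat_exp k x <= k.+1`!%:R * x.
Proof.
rewrite /flat_exp; case: ifPn => [x0 _|x0 xge]; last by rewrite mulr_ge0.
have y0 : 0 < x^-1 by rewrite invr_gt0.
have := @expR_ge1Dxn R x^-1 k (ltW y0) => H.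
have {}H : x^-1 ^+ k.+1 <= k.+1`!%:R * expR x^-1.
  rewrite mulrC -ler_pdivrMr ?ltr0n ?fact_gt0//.
  by apply: le_trans H; rewrite lerDr.
rewrite expRN ler_pdivrMr ?expR_gt0//.
rewrite mulrAC -ler_pdivrMr//.
by rewrite -exprSr.
Qed.

Lemma is_derive_flat_exp k x :
  is_derive x 1 (flat_exp k) (flat_exp k.+2 x - k%:R * flat_exp k.+1 x).
Proof.
have [x0|x0|->] := ltrgtP x 0.
- rewrite !flat_exp_le0 ?mulr0 ?subr0 ?(ltW x0)//.
  apply: (near_eq_is_derive (f := cst 0)).
  + near=> y; rewrite flat_exp_le0//= ltW//; near: y; exact: lt_nbhsl.
- apply: (@near_eq_is_derive _ _ _ (fun y : R => (y^-1) ^+ k * expR (- y^-1))).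
  + by near=> y; rewrite /flat_exp ifT//; near: y; exact: lt_nbhsr.
  + have dV : is_derive x 1 (fun y : R => y^-1) (- (x ^- 2)).
      have := @is_deriveV R id x 1 1; rewrite gt_eqF// => /(_ isT).
      by rewrite /GRing.scale/= mulr1; apply; exact: is_derive_id.
    have dE : is_derive x 1 (fun y : R => expR (- y^-1)) (expR (- x^-1) * x^-1 ^+ 2).
      apply: (@is_derive1_comp _ expR (fun y => - y^-1)).
      by rewrite exprVn -[X in is_derive _ _ _ X]opprK; exact: is_deriveN.
    have dX : is_derive x 1 (fun y : R => y^-1 ^+ k)
       (- k%:R * x^-1 ^+ k.+1).
      have dP : is_derive (x^-1) 1 (fun y : R => y ^+ k) (k%:R * x^-1 ^+ k.-1).
        apply: DeriveDef; first exact: exprn_derivable.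
        by rewrite exp_derive /GRing.scale/= mulr1.
      have := @is_derive1_comp _ (fun y : R => y ^+ k) (fun y : R => y^-1) x _ _ dP dV.
      rewrite (_ : _ * - _ = - k%:R * x^-1 ^+ k.+1)//.
      by case: k {dP} => [|k]; rewrite -exprVn !exprS expr0 /=; ring.
    apply: is_derive_eq.
    by rewrite /flat_exp x0 /GRing.scale/= !exprS; ring.
- rewrite !flat_exp_le0// mulr0 subr0.
  suff cv : h^-1 *: (flat_exp k (h *: 1 + 0) - flat_exp k 0) @[h --> 0^'] --> 0.
    apply: DeriveDef; first by apply/cvg_ex; exists 0.
    by apply/cvg_lim => //; exact: Rhausdorff.
  rewrite flat_exp_le0//.
  apply: (@squeeze_cvgr _ _ _ _ (fun h => - (k.+2`!%:R * `|h|)) (fun h => k.+2`!%:R * `|h|)).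
  + near=> h.
    rewrite /GRing.scale/= mulr1 addr0 subr0.
    (* For [h > 0] the quotient is [flat_exp k.+1 h], so the linear bound for index [k.+1] applies;
       for [h <= 0] it is [0]. *)
    suff : `|h^-1 * flat_exp k h| <= k.+2`!%:R * `|h| by rewrite ler_norml.
    have [h0|h0] := leP h 0.
      by rewrite flat_exp_le0// mulr0 normr0 mulr_ge0.
    rewrite (gtr0_norm h0) ger0_norm.
      apply: le_trans (flat_exp_le k.+1 (ltW h0)).
      by rewrite /flat_exp h0 exprS mulrA.
    by rewrite mulr_ge0 ?flat_exp_ge0// invr_ge0 ltW.
  + rewrite -[X in _ --> X]oppr0; apply: cvgN.
    rewrite -[X in _ --> X](mulr0 (k.+2`!%:R)); apply: cvgMr.
    rewrite -[X in _ --> X](normr0 R); apply: cvg_norm; exact: nbhs_dnbhs.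
  + rewrite -[X in _ --> X](mulr0 (k.+2`!%:R)); apply: cvgMr.
    rewrite -[X in _ --> X](normr0 R); apply: cvg_norm; exact: nbhs_dnbhs.
Unshelve. all: by end_near. Qed.

End smooth_functions.

(** * Smooth bumps on []0, w[] and the smooth steps that are their primitives *)

Section bump.
Context {R : realType}.
Implicit Types (f g : R -> R).

(* Closed under differentiation, which makes all members smooth. *)
Inductive bump_span (w : R) : (R -> R) -> Prop :=
| bump_span_base k l : bump_span w (fun x => flat_exp k x * flat_exp l (w - x))
| bump_span_comb (c : R) f g : bump_span w f -> bump_span w g ->
    bump_span w (fun x => c * f x + g x).

Lemma bump_span_is_derive w f : bump_span w f ->
  exists2 g, bump_span w g & forall x : R, is_derive x 1 f (g x).
Proof.
elim=> {f} [k l|c f g _ [f' sf' ff'] _ [g' sg' gg']].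
  pose B i j (x : R) := flat_exp i x * flat_exp j (w - x).
  (* The product rule, nested in the shape [c * f + g] that [bump_span_comb] accepts. The inner
     function [w - x] reverses the signs of the terms that raise [l]. *)
  exists (fun x => l%:R * B k l.+1 x + (-1 * B k l.+2 x +
                   (- k%:R * B k.+1 l x + B k.+2 l x))).
    by do 3 (apply: bump_span_comb; first exact: bump_span_base);
      exact: bump_span_base.
  move=> x.
  have dr : is_derive x 1 (fun y => flat_exp l (w - y))
      ((flat_exp l.+2 (w - x) - l%:R * flat_exp l.+1 (w - x)) * -1).
    apply: (@is_derive1_comp _ (flat_exp l) (fun y => w - y)).
      exact: is_derive_flat_exp.
    by rewrite -[X in is_derive _ _ _ X]sub0r; exact: is_deriveB.
  apply: is_derive_eq.
    exact: (@is_deriveM _ _ (flat_exp k) _ _ _ _ _ (is_derive_flat_exp k x) dr).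
  by rewrite /B /GRing.scale/=; ring.
exists (fun x => c * f' x + g' x); first exact: bump_span_comb.
move=> x; apply: is_deriveD; exact: (@is_deriveZ _ _ _ f c).
Qed.

Lemma bump_span_smooth w f : bump_span w f -> smooth f.
Proof.
move: f; apply: smooth_coind => f /bump_span_is_derive[g sg fg].
split=> [x|]; first by have [] := fg x.
rewrite (_ : derive1 f = g)//.
by apply/funext => x; rewrite derive1E; exact: derive_val.
Qed.

Lemma smooth_continuous f : smooth f -> continuous f.
Proof.
move=> sf x; apply/differentiable_continuous/derivable1_diffP.
exact: (sf 0%N).
Qed.

Lemma continuous_integrable_segment f (a b : R) : {within `[a, b], continuous f} ->
  lebesgue_measure.-integrable `[a, b] (EFin \o f).
Proof. by apply: continuous_compact_integrable; exact: segment_compact. Qed.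

Lemma exists_primitive f : continuous f -> (forall x, x <= 0 -> f x = 0) ->
  exists2 F : R -> R, forall x : R, is_derive x 1 F (f x) &
    forall x, x <= 0 -> F x = 0.
Proof.
(* The base point [-1] lies strictly left of [0], so each [x >= 0] is interior to [[-1, x + 1]] and
   the fundamental theorem applies there; for [x < 0], [F] vanishes near [x]. *)
move=> cf f0; pose F x := \int[lebesgue_measure]_(t in `[-1, x]) f t.
have F0 x : x <= 0 -> F x = 0.
  move=> x0; rewrite /F (@eq_Rintegral _ _ _ _ _ (cst 0)) ?Rintegral_cst ?mul0r//.
  by move=> t /[!inE]/= /[!in_itv]/= /andP[_ tx]; rewrite f0// (le_trans tx).
exists F => // x; have [x0|x0] := ltP x 0.
  rewrite f0 ?(ltW x0)//.
  apply: (@near_eq_is_derive _ _ _ (cst 0)).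
  by near=> y; rewrite F0//= ltW//; near: y; exact: lt_nbhsl.
have [||//||dF F'] := @continuous_FTC1_closed R f (-1) x (x + 1).
- by rewrite ltrDl.
- apply: continuous_integrable_segment.
  exact: continuous_subspaceT.
- by apply: lt_le_trans x0; rewrite oppr_lt0.
- exact: cf.
- by apply: DeriveDef; [exact: dF|rewrite -derive1E; exact: F'].
Unshelve. all: by end_near. Qed.

Lemma is_derive_MVT f g (a b : R) : a <= b ->
  (forall x : R, is_derive x 1 f (g x)) ->
  exists2 c, c \in `[a, b] & f b - f a = g c * (b - a).
Proof.
move=> ab fg; apply: MVT_segment => //.
by apply: derivable_within_continuous => x _; have [] := fg x.
Qed.

(** The bump [s] is [exp(-1/x) exp(-1/(w-x))] inside []0, w[], and [S] is its primitive. *)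
Lemma exists_smooth_step (w : R) : 0 < w -> exists S s : R -> R,
  [/\ (forall x : R, is_derive x 1 S (s x)), smooth s, forall x, 0 <= s x,
      forall x, x \notin `]0, w[ -> s x = 0 &
      [/\ forall x, x <= 0 -> S x = 0, forall x, w <= x -> S x = S w & 0 < S w]].
Proof.
move=> w0; pose s x := flat_exp 0 x * flat_exp 0 (w - x).
have ss : smooth s by apply: bump_span_smooth; exact: bump_span_base.
have s_ge0 x : 0 <= s x by rewrite mulr_ge0// flat_exp_ge0.
have s0 x : x \notin `]0, w[ -> s x = 0.
  rewrite in_itv/= negb_and -!leNgt => /orP[x0|wx]; rewrite /s.
    by rewrite flat_exp_le0// mul0r.
  by rewrite [X in _ * X]flat_exp_le0 ?mulr0// subr_le0.
have [|S Ss S0] := @exists_primitive s (smooth_continuous ss).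
  by move=> x x0; rewrite s0// in_itv/= negb_and -leNgt x0.
exists S, s; split=> //; split=> //.
  move=> x wx; have [c] := is_derive_MVT wx Ss.
  rewrite in_itv/= => /andP[wc _] /eqP; rewrite s0 ?mul0r; last first.
    by rewrite in_itv/= negb_and -!leNgt wc orbT.
  by rewrite subr_eq0 => /eqP.
have Sle x y : x <= y -> S x <= S y.
  move=> xy; have [c _ E] := is_derive_MVT xy Ss.
  by rewrite -subr_ge0 E mulr_ge0// subr_ge0.
(* To get [0 < S w], the mean value theorem is applied on an inner segment where [s] is strictly
   positive; monotonicity of [S] does the rest. *)
have w4 : w / 4 <= w * 3 / 4 by lra.
have [c] := is_derive_MVT w4 Ss; rewrite in_itv/= => /andP[c1 c2] E.
have : 0 < S (w * 3 / 4) - S (w / 4).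
  rewrite E mulr_gt0//; last by lra.
  by rewrite mulr_gt0// flat_exp_gt0//; lra.
rewrite subr_gt0 => lt1.
rewrite -(S0 0)//; apply: (@le_lt_trans _ _ (S (w / 4))).
  by apply: Sle; lra.
by apply: lt_le_trans lt1 _; apply: Sle; lra.
Qed.

End bump.

(** * The du Bois-Reymond lemma: a continuous function orthogonal to all derivatives of test
    functions is constant *)

Section du_Bois_Reymond.
Context {R : realType}.
Implicit Types (f g h psi : R -> R).

Lemma Rintegral_FTC2 f g (a b : R) : a < b -> continuous g ->
  (forall x : R, is_derive x 1 f (g x)) ->
  \int[lebesgue_measure]_(x in `[a, b]) g x = f b - f a.
Proof.
move=> ab cg fg; rewrite /Rintegral (@continuous_FTC2 _ g f)//.
- exact: continuous_subspaceT.
- have cf x : {for x, continuous f}.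
    by apply/differentiable_continuous/derivable1_diffP; have [] := fg x.
  split=> [x _||]; first by have [] := fg x.
  + by apply: cvg_at_right_filter; exact: cf.
  + by apply: cvg_at_left_filter; exact: cf.
- by move=> x _; rewrite derive1E; exact: derive_val.
Qed.

Lemma eq_Rintegral_segment g f (a b : R) :
  (forall x, x \in `[a, b] -> f x = g x) ->
  \int[lebesgue_measure]_(x in `[a, b]) f x =
  \int[lebesgue_measure]_(x in `[a, b]) g x.
Proof. by move=> fg; apply: eq_Rintegral => x /[!inE]; exact: fg. Qed.

Lemma within_continuousM f g (a b : R) : {within `[a, b], continuous f} ->
  {within `[a, b], continuous g} ->
  {within `[a, b], continuous (fun x => f x * g x)}.
Proof. by move=> cf cg x; apply: continuousM; [exact: cf|exact: cg]. Qed.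

Lemma within_continuousB f g (a b : R) : {within `[a, b], continuous f} ->
  {within `[a, b], continuous g} ->
  {within `[a, b], continuous (fun x => f x - g x)}.
Proof. by move=> cf cg x; apply: continuousB; [exact: cf|exact: cg]. Qed.

Lemma within_continuous_smooth f (a b : R) : smooth f ->
  {within `[a, b], continuous f}.
Proof. by move=> sf; exact/continuous_subspaceT/smooth_continuous. Qed.

Definition annihilates_derivatives (a b : R) h := forall psi,
  test_function a b psi ->
  \int[lebesgue_measure]_(x in `[a, b]) (h x * (psi^`())%classic x) = 0.

(** Left of [c] both steps vanish, and right of [d + w] both equal [S w] and cancel, so the support
    lies in [[c, d + w]], a compact subset of []a, b[]. *)
Lemma test_function_step_sub (a b c d w : R) (S : R -> R) :
  a < c -> c < d -> 0 < w -> d + w < b -> smooth S ->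
  (forall x, x <= 0 -> S x = 0) -> (forall x, w <= x -> S x = S w) ->
  test_function a b (fun x => S (x - c) - S (x - d)).
Proof.
move=> ac cd w0 dwb sS S0 S1.
have supp : tsupport (fun x => S (x - c) - S (x - d)) `<=` `[c, d + w].
  rewrite /tsupport [X in _ `<=` X](closure_id _).1; last exact: itv_closed.
  apply: closureS => x /=; rewrite in_itv/= => /eqP xE.
  apply/andP; split; rewrite leNgt; apply/negP => xlt; apply: xE.
    by rewrite !S0 ?subr0//; lra.
  by rewrite S1 ?[S (x - d)]S1 ?subrr//; lra.
split; first exact: smooth_shift_sub.
split.
  apply: subclosed_compact supp; first exact: closed_closure.
  exact: segment_compact.
by apply: subset_trans supp _ => x /=; rewrite !in_itv/= => /andP[? ?]; lra.
Qed.

(* Test against the difference of two unit steps, one rising near [c] and the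
   other near [d]. *)
Lemma annihilates_derivatives_le (a b c d : R) h :
  {within `[a, b], continuous h} -> annihilates_derivatives a b h ->
  a < c -> c < d -> d < b -> h d <= h c.
Proof.
move=> ch Hh ac cd db; rewrite leNgt; apply/negP => hcd.
have ab : a < b by lra.
have near_cst (e p : R) : 0 < e -> a < p < b ->
    exists2 r : R, 0 < r & forall x, p < x < p + r -> `|h p - h x| <= e.
  move=> e0 pab.
  have : {for p, continuous h}.
    by apply: (within_continuous_continuous ab ch); rewrite in_itv.
  move=> /cvgrPdist_le/(_ _ e0)/nbhs_ballP[r /= r0 H].
  exists r => // x /andP[px xr]; apply: H.
  by rewrite /ball/= distrC ger0_norm; lra.
(* With a quarter of the gap as tolerance, the values of [h] near [c] and near [d] stay separated by
   half the gap. *)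
set e := (h d - h c) / 4; have e0 : 0 < e by rewrite /e; lra.
have [|r1 r10 H1] := near_cst e c e0; first by apply/andP; split; lra.
have [|r2 r20 H2] := near_cst e d e0; first by apply/andP; split; lra.
(* Halving makes [w] strictly smaller than both continuity radii and than [b - d]. *)
pose w := Num.min r1 (Num.min r2 (b - d)) / 2.
have w0 : 0 < w.
  by rewrite divr_gt0// !lt_min r10 r20/= subr_gt0.
have [wr1 wr2 wb] : [/\ w < r1, w < r2 & d + w < b].
  have : w * 2 <= Num.min r1 (Num.min r2 (b - d)) by rewrite /w; lra.
  by rewrite !le_min => /and3P[? ? ?]; split; lra.
have [S [s [Ss ss s_ge0 s0 [S0 S1 Sw]]]] := exists_smooth_step w0.
have sS := smooth_primitive Ss ss.
have tpsi := test_function_step_sub ac cd w0 wb sS S0 S1.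
have := Hh _ tpsi.
have dS (p x : R) : is_derive x 1 (fun y => S (y - p)) (s (x - p)).
  exact: is_derive_shift.
have cs (p : R) : continuous (fun y => s (y - p)).
  move=> x; apply: (@continuous_comp _ _ _ (fun y => y - p) s).
    by apply: cvgB; [exact: cvg_id|exact: cvg_cst].
  exact: smooth_continuous.
rewrite (@eq_Rintegral_segment (fun x => h x * (s (x - c) - s (x - d)))); last first.
  move=> x _; congr (_ * _); rewrite derive1E.
  by apply: derive_val; exact: is_deriveB.
(* [A] bounds [h] from above on the bump at [c], and [B] bounds it from below on the bump at [d].
   Replacing [h] by these constants gives [0 <= (A - B) * S w], although
   [A - B = - (h d - h c) / 2 < 0]. *)
pose A := h c + e; pose B := h d - e.
have dT (x : R) : is_derive x 1 (fun y => A * S (y - c) - B * S (y - d))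
    (A * s (x - c) - B * s (x - d)).
  by apply: is_deriveB; apply: is_deriveZ.
have cT : continuous (fun x => A * s (x - c) - B * s (x - d)).
  by move=> x; apply: cvgB; apply: cvgMr; exact: cs.
have := Rintegral_FTC2 ab cT dT.
rewrite (S1 (b - c)); last by lra.
rewrite (S1 (b - d)); last by lra.
rewrite (S0 (a - c)); last by lra.
rewrite (S0 (a - d)); last by lra.
rewrite !mulr0 !subr0 => ET I0.
have : 0 <= A * S w - B * S w.
  rewrite -I0 -ET; apply: le_Rintegral => //.
  - apply: continuous_integrable_segment; apply: within_continuousM => //.
    by apply: continuous_subspaceT => x; apply: cvgB; exact: cs.
  - by apply: continuous_integrable_segment; exact: continuous_subspaceT.
  move=> x _; rewrite mulrBr; apply: lerB.
    have [xc|/s0 ->] := boolP (x - c \in `]0, w[); last by rewrite !mulr0.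
    apply: ler_wpM2r => //; move: xc; rewrite in_itv/= => /andP[? ?].
    have : `|h c - h x| <= e by apply: H1; apply/andP; split; lra.
    by rewrite ler_norml /A => /andP[? ?]; lra.
  have [xc|/s0 ->] := boolP (x - d \in `]0, w[); last by rewrite !mulr0.
  apply: ler_wpM2r => //; move: xc; rewrite in_itv/= => /andP[? ?].
  have : `|h d - h x| <= e by apply: H2; apply/andP; split; lra.
  by rewrite ler_norml /B => /andP[? ?]; lra.
rewrite -mulrBl pmulr_lge0// /A /B /e; lra.
Qed.

(** The inequality [h d <= h c], applied to [h] and to [- h], makes [h] constant on the open
    interval; one-sided limits carry the value to the endpoints. *)
Lemma du_Bois_Reymond (a b : R) h : a < b ->
  {within `[a, b], continuous h} -> annihilates_derivatives a b h ->
  forall x, x \in `[a, b] -> h x = h a.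
Proof.
move=> ab ch Hh; pose m := (a + b) / 2.
have cNh : {within `[a, b], continuous (fun x => - h x)}.
  by move=> x; apply: continuousN; exact: ch.
have HNh : annihilates_derivatives a b (fun x => - h x).
  move=> psi tpsi.
  rewrite (@eq_Rintegral_segment (fun x => -1 * (h x * (psi^`())%classic x))); last first.
    by move=> x _; ring.
  rewrite RintegralZl ?Hh ?mulr0//.
  apply: continuous_integrable_segment; apply: within_continuousM => //.
  by apply: within_continuous_smooth; apply: smooth_derive; case: tpsi.
have eqlt c d : a < c -> c < d -> d < b -> h c = h d.
  move=> ac cd db; apply/eqP; rewrite eq_le.
  rewrite (annihilates_derivatives_le ch Hh ac cd db) andbT.
  by rewrite -lerN2; exact: (annihilates_derivatives_le cNh HNh ac cd db).
have int x : x \in `]a, b[ -> h x = h m.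
  rewrite in_itv/= => /andP[ax xb].
  by have [xm|xm|->//] := ltgtP x m; [|apply/esym]; apply: eqlt => //; rewrite /m; lra.
have [_ ha hb] := (continuous_within_itvP h ab).1 ch.
have cm (F : set_system R) : ProperFilter F ->
    (\forall y \near F, y \in `]a, b[) -> h @ F --> h m.
  move=> PF Fab; apply: cvg_near_cst; apply: filterS Fab => y yab; exact: int.
have ham : h a = h m.
  apply: (@cvg_unique _ (@Rhausdorff R) _ _ _ _ ha); apply: cm.
  near=> y; rewrite in_itv/=; apply/andP; split=> //.
have hbm : h b = h m.
  apply: (@cvg_unique _ (@Rhausdorff R) _ _ _ _ hb); apply: cm.
  near=> y; rewrite in_itv/=; apply/andP; split=> //.
move=> x; rewrite in_itv/= ham => /andP[].
rewrite le_eqVlt => /predU1P[<-//|ax].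
rewrite le_eqVlt => /predU1P[->//|xb].
by apply: int; rewrite in_itv/= ax.
Unshelve. all: by end_near. Qed.

End du_Bois_Reymond.

(** * From derivatives relative to the segment to ordinary derivatives and continuity *)

Section one_sided_derivative.
Context {R : realType}.
Implicit Types (f : R -> R) (a b x : R).

Lemma C1_seg_is_derive a b f x : C1_seg a b f -> x \in `]a, b[ ->
  is_derive x 1 f (derive_seg a b f x).
Proof.
move=> [df _] xab.
have := df x (subset_itv_oo_cc xab); rewrite /derivable_seg => cv.
have {}cv : diffquo f x @ within `[a, b] x^' --> derive_seg a b f x by [].
have {}cv : diffquo f x @ x^' --> derive_seg a b f x.
  apply: cvg_trans cv; apply: cvg_app.
  (* Near an interior point all points belong to the segment, so restricting the limit to [[a, b]]
     changes nothing. *)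
  move=> A; rewrite /within/= => H; near=> y.
  have : y \in `[a, b] -> A y by near: y; exact: H.
  apply; apply: subset_itv_oo_cc; near: y.
  by apply: nbhs_dnbhs; exact: near_in_itvoo.
have cv0 : h^-1 *: (f (h *: 1 + x) - f x) @[h --> 0^'] --> derive_seg a b f x.
  apply/cvgrPdist_le => e e0; move/cvgrPdist_le : cv => /(_ _ e0).
  rewrite !near_withinE => /nbhs_ballP[r /= r0 H].
  apply/nbhs_ballP; exists r => // h; rewrite /ball/= sub0r normrN => hr h0.
  have := H (h + x); rewrite /ball/= opprD addrCA subrr addr0 normrN => /(_ hr).
  have -> : h + x != x by rewrite -subr_eq0 addrK.
  move=> /(_ isT); rewrite /diffquo addrK /GRing.scale/= mulr1.
  by rewrite [h^-1 * _]mulrC.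
apply: DeriveDef; first by apply/cvg_ex; exists (derive_seg a b f x).
by apply/cvg_lim => //; exact: Rhausdorff.
Unshelve. all: by end_near. Qed.

Lemma C1_seg_continuous a b f : C1_seg a b f -> {within `[a, b], continuous f}.
Proof.
move=> [df _]; apply/subspace_continuousP => x xab.
have {}cv : diffquo f x @ within `[a, b] x^' --> derive_seg a b f x.
  exact: df.
(* Continuity follows from [f y = f x + diffquo f x y * (y - x)], where the quotient converges and
   [y - x] tends to [0]. This holds off [x] only; the point [y = x] is added at the end. *)
have : {near within `[a, b] x^', (fun y => f x + diffquo f x y * (y - x)) =1 f}.
  rewrite near_withinE near_withinE; apply: nearW => y yx _.
  by rewrite /diffquo divfK ?subr_eq0//; ring.
have cyx : y - x @[y --> within `[a, b] x^'] --> (0 : R).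
  rewrite -(subrr x); apply: cvgB; last exact: cvg_cst.
  by move=> A xA; apply: filterS (nbhs_dnbhs xA) => y Ay _.
move=> /near_eq_cvg H.
have cf : f x + diffquo f x y * (y - x) @[y --> within `[a, b] x^'] --> f x.
  rewrite -[X in _ --> X]addr0; apply: cvgD; first exact: cvg_cst.
  by rewrite -[X in _ --> X](mulr0 (derive_seg a b f x)); exact: cvgM.
have {}H : f @ within `[a, b] x^' --> f x by exact: cvg_trans H cf.
apply/cvgrPdist_le => e e0; move/cvgrPdist_le : H => /(_ _ e0).
rewrite !near_withinE; apply: filterS => y H yab.
have [->|yx] := eqVneq y x; first by rewrite subrr normr0 ltW.
exact: H.
Qed.

End one_sided_derivative.

(** * Distributional derivatives of continuous functions, their primitives and the Alexiewicz
    norm *)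

Section Alexiewicz.
Context {R : realType}.
Implicit Types (f g psi : R -> R) (a b x : R).

Lemma within_continuous_norm a b g : {within `[a, b], continuous g} ->
  {within `[a, b], continuous (fun x => `|g x|)}.
Proof. by move=> cg x; apply: cvg_norm; exact: cg. Qed.

Lemma within_continuous_bounded a b g : {within `[a, b], continuous g} ->
  exists2 M : R, 0 <= M & forall x, x \in `[a, b] -> `|g x| <= M.
Proof.
move=> cg; have [ba|ab] := ltP b a.
  by exists 0 => // x; rewrite in_itv/= => /andP[? ?]; lra.
have [c _ H] := EVT_max ab (within_continuous_norm cg).
by exists `|g c|.
Qed.

(** This includes an empty or unbounded image, where [sup] takes its default value [0]. *)
Lemma sup_image_norm_ge0 (K : set R) g : 0 <= sup [set `|g x| | x in K].
Proof.
have [[[y Ky] ubK]|/sup_out ->//] := pselect (has_sup [set `|g x| | x in K]).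
apply: le_trans (ub_le_sup ubK Ky); case: Ky => x _ <-; exact: normr_ge0.
Qed.

Lemma within_continuous_le_sup (K : set R) a b g x : K `<=` `[a, b] ->
  {within `[a, b], continuous g} -> K x -> `|g x| <= sup [set `|g x| | x in K].
Proof.
move=> Kab cg Kx; apply: ub_le_sup; last by exists x.
have [M _ H] := within_continuous_bounded cg.
by exists M => _ [y Ky <-]; apply: H; exact: Kab.
Qed.

Lemma notin_tsupport psi x : ~ tsupport psi x -> \near x, psi x = 0.
Proof.
move=> xpsi; have : open (~` tsupport psi) by exact/closed_openC/closed_closure.
move/(_ x xpsi); apply: filterS => y ypsi.
by apply: contrapT => /eqP psiy; apply: ypsi; exact: subset_closure.
Qed.

Lemma derive1_notin_tsupport psi x : ~ tsupport psi x -> (psi^`())%classic x = 0.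
Proof.
move=> /notin_tsupport psi0; rewrite derive1E.
by rewrite (@near_eq_derive _ _ _ psi (cst 0))// derive_cst.
Qed.

Lemma test_function_bnd a b psi : test_function a b psi -> psi a = 0 /\ psi b = 0.
Proof.
move=> [_ [_ H]].
have psi0 x : x \notin `]a, b[ -> psi x = 0.
  by move=> /negP xab; apply: contrapT => /eqP psix; apply: xab; exact/H/subset_closure.
by split; apply: psi0; rewrite in_itv/= ltxx ?andbF.
Qed.

Lemma continuous_derive_test_function a b psi : test_function a b psi ->
  {within `[a, b], continuous (psi^`())%classic}.
Proof. by move=> [spsi _]; apply: within_continuous_smooth; exact: smooth_derive. Qed.

Lemma smooth_is_derive psi x : smooth psi ->
  is_derive x 1 psi ((psi^`())%classic x).
Proof. by move=> spsi; rewrite derive1E; apply/derivableP; exact: (spsi 0%N). Qed.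

Lemma integral_derive_test_function a b psi : a < b -> test_function a b psi ->
  \int[lebesgue_measure]_(x in `[a, b]) (psi^`())%classic x = 0.
Proof.
move=> ab tpsi; have [spsi _] := tpsi.
have [psia psib] := test_function_bnd tpsi.
rewrite -(subrr (psi b)) {2}psib -psia; apply: Rintegral_FTC2 => //.
- by apply: smooth_continuous; exact: smooth_derive.
- by move=> x; exact: smooth_is_derive.
Qed.

Lemma distribution_distr_derive a b g : a < b -> {within `[a, b], continuous g} ->
  Defs.distribution a b (distr_derive a b g).
Proof.
move=> ab cg; split.
  move=> c phi psi tphi tpsi; rewrite /distr_derive.
  have ig chi : test_function a b chi -> lebesgue_measure.-integrable `[a, b]
      (EFin \o (fun x => g x * (chi^`())%classic x)).
    move=> tchi; apply: continuous_integrable_segment.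
    by apply: within_continuousM => //; exact: continuous_derive_test_function.
  rewrite (@eq_Rintegral_segment _ (fun x => c * (g x * (phi^`())%classic x)
                          + g x * (psi^`())%classic x)).
    rewrite RintegralD//; last 2 first.
    - apply: continuous_integrable_segment.
      apply: within_continuousM; first by apply: continuous_subspaceT; exact: cst_continuous.
      by apply: within_continuousM => //; exact: continuous_derive_test_function.
    - exact: ig.
    have := @RintegralZl _ _ _ lebesgue_measure _ _ c (measurable_itv _) (ig _ tphi).
    by move=> ->; rewrite opprD mulrN.
  move=> x _; rewrite [X in _ * X](_ : _ = c * (phi^`())%classic x + (psi^`())%classic x).
    by ring.
  rewrite derive1E; apply: derive_val; apply: is_deriveD.
    by apply: is_deriveZ; apply: smooth_is_derive; case: tphi.
  by apply: smooth_is_derive; case: tpsi.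
move=> K _ Kab; have [M M0 gM] := within_continuous_bounded cg.
(* The functional has order at most one: the integral is bounded by [M * (b - a)] times the supremum
   of the first derivative, and the term [k = 0] of the sum is nonnegative. *)
exists (M * (b - a)), 1%N => psi tpsi psiK.
rewrite !big_ord_recr big_ord0/= add0r.
set s0 := sup _; set s1 := sup _.
have s00 : 0 <= s0 by exact: sup_image_norm_ge0.
have s10 : 0 <= s1 by exact: sup_image_norm_ge0.
have Kcc : K `<=` `[a, b] by move=> x /Kab; exact: subset_itv_oo_cc.
have cpsi := continuous_derive_test_function tpsi.
have psi1 x : `|(psi^`())%classic x| <= s1.
  have [Kx|Kx] := pselect (K x); first exact: within_continuous_le_sup cpsi Kx.
  by rewrite derive1_notin_tsupport ?normr0// => /psiK.
have ig : lebesgue_measure.-integrable `[a, b]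
    (EFin \o (fun x => g x * (psi^`())%classic x)).
  by apply: continuous_integrable_segment; exact: within_continuousM.
rewrite /distr_derive normrN.
apply: (@le_trans _ _ (M * (b - a) * s1)); last first.
  by rewrite ler_wpM2l ?lerDr// mulr_ge0// subr_ge0 ltW.
apply: le_trans (le_normr_Rintegral _ ig) _ => //.
have -> : M * (b - a) * s1 = \int[lebesgue_measure]_(x in `[a, b]) (M * s1).
  rewrite Rintegral_cst//= lebesgue_measure_itv/= lte_fin ab/=; ring.
apply: le_Rintegral => //.
- apply: continuous_integrable_segment; apply: within_continuous_norm.
  exact: within_continuousM.
- by apply: continuous_integrable_segment; apply: continuous_subspaceT; exact: cst_continuous.
- by move=> x xab; rewrite normrM; apply: ler_pM => //; exact: gM.
Qed.

(** Subtracting the constant [g a] leaves the distribution unchanged because the derivative of a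
    test function has integral zero. *)
Lemma primitives_distr_derive a b g : a < b -> {within `[a, b], continuous g} ->
  primitives a b (distr_derive a b g) (fun x => g x - g a).
Proof.
move=> ab cg.
have cga : {within `[a, b], continuous (fun=> g a)}.
  by apply: continuous_subspaceT; exact: cst_continuous.
split; first by split; [exact: within_continuousB|rewrite subrr].
move=> psi tpsi; congr (- _).
have cpsi := continuous_derive_test_function tpsi.
apply/eqP; rewrite -subr_eq0 -RintegralB//; last 2 first.
- by apply: continuous_integrable_segment; exact: within_continuousM.
- apply: continuous_integrable_segment; apply: within_continuousM => //.
  exact: within_continuousB.
rewrite (@eq_Rintegral_segment _ (fun x => g a * (psi^`())%classic x)).
  rewrite RintegralZl//; last exact: continuous_integrable_segment.
  by rewrite integral_derive_test_function// mulr0.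
by move=> x _; ring.
Qed.

Lemma A_c_distr_derive a b g : a < b -> {within `[a, b], continuous g} ->
  A_c a b (distr_derive a b g).
Proof.
move=> ab cg; split; first exact: distribution_distr_derive.
by eexists; exact: primitives_distr_derive.
Qed.

(** The chosen primitive [F] and [g] define the same distribution, so [F - g] annihilates
    derivatives and is constant by [du_Bois_Reymond]; [F a = 0] fixes the constant. *)
Lemma primitive_distr_derive a b g : a < b -> {within `[a, b], continuous g} ->
  forall x, x \in `[a, b] -> primitive a b (distr_derive a b g) x = g x - g a.
Proof.
move=> ab cg x xab.
have : primitives a b (distr_derive a b g) (primitive a b (distr_derive a b g)).
  by apply: xgetPex; eexists; exact: primitives_distr_derive.
set F := primitive a b _ => -[[cF Fa] gF].
have := @du_Bois_Reymond _ a b (fun x => F x - g x) ab (within_continuousB cF cg).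
move=> H; have {}H : F x - g x = F a - g a.
  apply: H => // psi tpsi.
  have cpsi := continuous_derive_test_function tpsi.
  rewrite (@eq_Rintegral_segment _ (fun x => F x * (psi^`())%classic x -
    g x * (psi^`())%classic x)); last by move=> y _; ring.
  rewrite RintegralB//; try by
    apply: continuous_integrable_segment; exact: within_continuousM.
  have /eqP := gF _ tpsi; rewrite /distr_derive eqr_opp => /eqP ->.
  by rewrite subrr.
by rewrite Fa in H; lra.
Qed.

Lemma le_alexiewicz_norm a b g : a < b -> {within `[a, b], continuous g} ->
  forall x, x \in `[a, b] -> `|g x - g a| <= alexiewicz_norm a b (distr_derive a b g).
Proof.
move=> ab cg.
have aab : a \in `[a, b] by rewrite in_itv/= lexx ltW.
have E y : y \in `[a, b] -> cp_integral a b (distr_derive a b g) y = g y - g a.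
  by move=> yab; rewrite /cp_integral !primitive_distr_derive// subrr subr0.
move=> x xab; apply: ub_le_sup; last by exists x => //; rewrite E.
(* Boundedness makes the norm a genuine supremum instead of the default value of [sup]. *)
have [|M _ gM] := @within_continuous_bounded a b (fun x => g x - g a).
  apply: within_continuousB => //.
  by apply: continuous_subspaceT; exact: cst_continuous.
by exists M => _ [y yab <-]; rewrite E// gM.
Qed.

End Alexiewicz.

(** * Error of the trapezoidal rule, on one subinterval and then composite *)

Section trapezoid.
Context {R : realType}.
Implicit Types (f g : R -> R) (a b c d : R).

Lemma Rintegral_affine (A B r p q : R) : p < q ->
  \int[lebesgue_measure]_(x in `[p, q]) (A + B * (x - r)) =
  A * (q - p) + B / 2 * ((q - r) ^+ 2 - (p - r) ^+ 2).
Proof.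
move=> pq.
have dF (x : R) : is_derive x 1 (fun y : R => A * y + B / 2 * ((y - r) * (y - r)))
    (A + B * (x - r)).
  have d1 : is_derive x 1 (fun y : R => y - r) 1.
    by rewrite -[X in is_derive _ _ _ X]subr0; exact: is_deriveB.
  apply: is_derive_eq.
  by rewrite /GRing.scale/= !mulr1; field.
have cF : continuous (fun y : R => A + B * (y - r)).
  move=> x; apply: cvgD; first exact: cvg_cst.
  by apply: cvgMr; apply: cvgB; [exact: cvg_id|exact: cvg_cst].
rewrite (Rintegral_FTC2 pq cF dF); ring.
Qed.

(** Integrate the two affine bounds. The base point [r] and the sign of [M] are left free, so that
    one statement serves [r = p] with slope error [M] and [r = q], where [x - r <= 0], with
    [- M]. *)
Lemma dist_Rintegral_affine f (A K M r p q : R) : p < q ->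
  {within `[p, q], continuous f} ->
  (forall x, x \in `[p, q] ->
     A + (K - M) * (x - r) <= f x <= A + (K + M) * (x - r)) ->
  `|\int[lebesgue_measure]_(x in `[p, q]) f x -
    (A * (q - p) + K / 2 * ((q - r) ^+ 2 - (p - r) ^+ 2))| <=
  M / 2 * ((q - r) ^+ 2 - (p - r) ^+ 2).
Proof.
move=> pq cf Hf.
have ci (B : R) : lebesgue_measure.-integrable `[p, q]
    (EFin \o (fun x : R => A + B * (x - r))).
  apply: continuous_integrable_segment; apply: continuous_subspaceT => x.
  apply: cvgD; first exact: cvg_cst.
  by apply: cvgMr; apply: cvgB; [exact: cvg_id|exact: cvg_cst].
have fi := continuous_integrable_segment cf.
have : \int[lebesgue_measure]_(x in `[p, q]) (A + (K - M) * (x - r)) <=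
       \int[lebesgue_measure]_(x in `[p, q]) f x.
  by apply: le_Rintegral => // x /Hf/andP[].
have : \int[lebesgue_measure]_(x in `[p, q]) f x <=
       \int[lebesgue_measure]_(x in `[p, q]) (A + (K + M) * (x - r)).
  by apply: le_Rintegral => // x /Hf/andP[].
rewrite !Rintegral_affine// ler_norml => H1 H2; apply/andP; split; lra.
Qed.

Lemma Rintegral_segment_split f a c b : a <= c -> c <= b ->
  {within `[a, b], continuous f} ->
  \int[lebesgue_measure]_(x in `[a, b]) f x =
  \int[lebesgue_measure]_(x in `[a, c]) f x +
  \int[lebesgue_measure]_(x in `[c, b]) f x.
Proof.
move=> ac cb cf; have fi := continuous_integrable_segment cf.
rewrite -[X in _ + X]Rintegral_itv_obnd_cbnd; last first.
  apply: integrableS fi => //; apply: subset_itv => //; rewrite bnd_simp.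
rewrite -(Rintegral_itvB fi) ?bnd_simp//; ring.
Qed.

Lemma trapezoid_error f g a b c d (K M : R) :
  a <= c -> c < d -> d <= b -> {within `[a, b], continuous f} ->
  (forall x, x \in `]a, b[ -> is_derive x 1 f (g x)) ->
  (forall x, x \in `]a, b[ -> `|g x - K| <= M) ->
  `|\int[lebesgue_measure]_(x in `[c, d]) f x - (d - c) / 2 * (f c + f d)|
  <= M * (d - c) ^+ 2 / 4.
Proof.
move=> ac cd db cf dfg gK; pose m := (c + d) / 2.
have sub p q : a <= p -> q <= b -> {within `[p, q], continuous f}.
  by move=> ap qb; apply: continuous_subspaceW cf; apply: subset_itv; rewrite bnd_simp.
(* By the mean value theorem, every chord of [f] has slope within [M] of [K]. *)
have lip p q : a <= p -> p <= q -> q <= b ->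
    (K - M) * (q - p) <= f q - f p <= (K + M) * (q - p).
  move=> ap; rewrite le_eqVlt => /predU1P[-> _|pq qb].
    by rewrite !subrr !mulr0 lexx.
  have dfpq x : x \in `]p, q[ -> is_derive x 1 f (g x).
    by rewrite in_itv/= => /andP[? ?]; apply: dfg; rewrite in_itv/=; apply/andP; split; lra.
  have [e] := MVT pq dfpq (sub p q ap qb).
  rewrite in_itv/= => /andP[pe eq] ->.
  have : `|g e - K| <= M by apply: gK; rewrite in_itv/=; apply/andP; split; lra.
  rewrite ler_norml => /andP[H1 H2].
  by apply/andP; split; apply: ler_wpM2r; lra.
have cm : c < m by rewrite /m; lra.
have md : m < d by rewrite /m; lra.
have H1 := @dist_Rintegral_affine f (f c) K M c c m cm.
have {H1} : `|\int[lebesgue_measure]_(x in `[c, m]) f x -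
   (f c * (m - c) + K / 2 * ((m - c) ^+ 2 - (c - c) ^+ 2))| <=
   M / 2 * ((m - c) ^+ 2 - (c - c) ^+ 2).
  apply: H1; first by apply: sub; lra.
  move=> x; rewrite in_itv/= => /andP[cx xm].
  have xb : x <= b by lra.
  have /andP[? ?] := lip c x ac cx xb.
  by apply/andP; split; lra.
(* On the right half [x - d] is nonpositive, which exchanges the upper and lower bounds; hence
   [- M]. *)
have H2 := @dist_Rintegral_affine f (f d) K (- M) d m d md.
have {H2} : `|\int[lebesgue_measure]_(x in `[m, d]) f x -
   (f d * (d - m) + K / 2 * ((d - d) ^+ 2 - (m - d) ^+ 2))| <=
   - M / 2 * ((d - d) ^+ 2 - (m - d) ^+ 2).
  apply: H2; first by apply: sub; lra.
  move=> x; rewrite in_itv/= => /andP[mx xd].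
  have ax : a <= x by lra.
  have /andP[? ?] := lip x d ax xd db.
  by apply/andP; split; lra.
rewrite (@Rintegral_segment_split f c m d) ?(ltW cm) ?(ltW md)//; last exact: sub.
set I1 := \int[lebesgue_measure]_(x in `[c, m]) f x.
set I2 := \int[lebesgue_measure]_(x in `[m, d]) f x.
have -> : m - c = (d - c) / 2 by rewrite /m; lra.
have -> : d - m = (d - c) / 2 by rewrite /m; lra.
have -> : m - d = - ((d - c) / 2) by rewrite /m; lra.
rewrite !subrr sqrrN expr0n/= subr0 sub0r.
(* The halves contribute [K * h^2 / 8] and [- K * h^2 / 8], which cancel, and an error of at most
   [M * h^2 / 8] each. *)
set h := (d - c); rewrite expr_div_n.
rewrite !ler_norml => /andP[? ?] /andP[? ?]; apply/andP; split; lra.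
Qed.

(** Each interior node is shared by two neighbouring subintervals, whence the factor [2]. *)
Lemma sum_adjacent (u : nat -> R) n : (0 < n)%N ->
  \sum_(i < n) (u i + u i.+1) = u 0%N + 2 * \sum_(1 <= i < n) u i + u n.
Proof.
case: n => // n _; elim: n => [|n IHn].
  by rewrite big_ord_recl big_ord0 big_geq//= mulr0 !addr0.
by rewrite big_ord_recr/= IHn [in RHS]big_nat_recr//=; ring.
Qed.

Lemma composite_trapezoid_error f g a b (K M : R) n : a < b -> (0 < n)%N ->
  {within `[a, b], continuous f} ->
  (forall x, x \in `]a, b[ -> is_derive x 1 f (g x)) ->
  (forall x, x \in `]a, b[ -> `|g x - K| <= M) ->
  `|\int[lebesgue_measure]_(x in `[a, b]) f x -
    (b - a) / (2 * n%:R) * (f a +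
      2 * \sum_(1 <= i < n) f (a + (b - a) * i%:R / n%:R) + f b)|
  <= M * (b - a) ^+ 2 / (4 * n%:R).
Proof.
move=> ab n0 cf dfg gK.
have nR0 : 0 < n%:R :> R by rewrite ltr0n.
pose h := (b - a) / n%:R; have h0 : 0 < h by rewrite divr_gt0// subr_gt0.
pose x_ i : R := a + (b - a) * i%:R / n%:R.
have xS i : x_ i.+1 = x_ i + h by rewrite /x_ /h -natr1; lra.
have x0 : x_ 0%N = a by rewrite /x_ mulr0 mul0r addr0.
have xn : x_ n = b by rewrite /x_ mulfK ?gt_eqF//; ring.
have ax i : a <= x_ i.
  elim: i => [|i IHi]; first by rewrite x0.
  by rewrite xS; lra.
have xb i : (i <= n)%N -> x_ i <= b.
  move=> iN; rewrite -xn /x_ lerD2l ler_pM2r ?invr_gt0// ler_pM2l ?subr_gt0//.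
  by rewrite ler_nat.
(* Induction on the number of subintervals covered: each has length [h] and adds an error of at most
   [M * h^2 / 4], with the same [K] throughout. *)
have H k : (k <= n)%N ->
   `|\int[lebesgue_measure]_(x in `[a, x_ k]) f x -
     h / 2 * \sum_(i < k) (f (x_ i) + f (x_ i.+1))| <= k%:R * (M * h ^+ 2 / 4).
  elim: k => [_|k IHk kn].
    by rewrite big_ord0 x0 set_itv1 Rintegral_set1 mulr0 subrr normr0 mul0r.
  rewrite (@Rintegral_segment_split f a (x_ k)) ?xS; [|exact: ax|by lra|]; last first.
    rewrite -xS; apply: continuous_subspaceW cf; apply: subset_itv; rewrite bnd_simp//.
    exact: xb.
  rewrite big_ord_recr/= xS.
  have := IHk (ltnW kn).
  have := @trapezoid_error f g a b (x_ k) (x_ k + h) K M (ax k) _ _ cf dfg gK.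
  rewrite -xS xb// xS (addrC (x_ k)) addrK => /(_ _ isT).
  have -> : x_ k < h + x_ k by lra.
  move=> /(_ isT).
  set I1 := \int[_]_(x in _) _; set I2 := \int[_]_(x in _) _; set s := \sum_(_ < _) _.
  rewrite -natr1 !ler_norml => /andP[? ?] /andP[? ?].
  by apply/andP; split; lra.
have := H n (leqnn n); rewrite (sum_adjacent (fun i => f (x_ i)) n0) xn x0.
have -> : n%:R * (M * h ^+ 2 / 4) = M * (b - a) ^+ 2 / (4 * n%:R).
  by rewrite /h; field; rewrite gt_eqF.
have -> : h / 2 = (b - a) / (2 * n%:R) by rewrite /h; field; rewrite gt_eqF.
by [].
Qed.

End trapezoid.

Theorem corollary5p3 (R : realType) (a b : R) (hab : a < b) (f : R -> R)
    (hf : C1_seg a b f) :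
  let f'' := distr_derive a b (derive_seg a b f) in
  let x_ (n i : nat) := a + (b - a) * i%:R / n%:R in
  [/\ A_c a b f'',
      exists E : R,
        \int[lebesgue_measure]_(x in `[a, b]) f x
          = (b - a) / 2 * (f a + f b) + E /\
        `|E| <= alexiewicz_norm a b f'' * (b - a) ^+ 2 / 4
    & forall n : nat, (1 <= n)%N ->
      exists E : R,
        \int[lebesgue_measure]_(x in `[a, b]) f x
          = (b - a) / (2 * n%:R) *
            (f a + 2 * \sum_(1 <= i < n) f (x_ n i) + f b) + E /\
        `|E| <= alexiewicz_norm a b f'' * (b - a) ^+ 2 / (4 * n%:R)].
Proof.
move=> f'' x_; have [_ cf'] := hf.
have cf := C1_seg_continuous hf.
have df x : x \in `]a, b[ -> is_derive x 1 f (derive_seg a b f x).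
  exact: C1_seg_is_derive.
(* This supplies the constants of the error lemmas: [K] is the derivative at [a] and [M] the
   Alexiewicz norm. *)
have bound x : x \in `]a, b[ ->
    `|derive_seg a b f x - derive_seg a b f a| <= alexiewicz_norm a b f''.
  by move=> xab; apply: le_alexiewicz_norm => //; exact: subset_itv_oo_cc.
split; first exact: A_c_distr_derive.
- exists (\int[lebesgue_measure]_(x in `[a, b]) f x - (b - a) / 2 * (f a + f b)).
  split; first by rewrite addrC subrK.
  exact: (trapezoid_error (lexx a) hab (lexx b) cf df bound).
- move=> n n1; eexists; split; first by rewrite addrC; apply/esym; exact: subrK.
  exact: (composite_trapezoid_error hab n1 cf df bound).
Qed.
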